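(* Let $\lambda$ be a Young diagram. Then we have the equalities of generating series $$\sum_{\mathbf{n}\in\mathrm{RPP}(\lambda)}\mathbf{q}^{\mathbf{n}}\Big|_{q_\Box=q_{j-i}}=\prod_{\Box\in\lambda}\frac{1}{1-\mathbf{p}_{\Box,\lambda}},$$ $$\sum_{\mathbf{n}\in\mathrm{SPP}(\lambda)}\mathbf{q}^{\mathbf{n}}\Big|_{q_\Box=q_{j-i}}=\prod_{\Box\notin\lambda}\frac{1}{1-\mathbf{p}_{\Box,\lambda}},$$ where the second product is over $\Box\in\mathbb{Z}_{\geq0}^2\setminus\lambda$, and $|_{q_\Box=q_{j-i}}$ means that for each box $\Box=(i,j)$ the variable $q_\Box$ is replaced by $q_{j-i}$.
   Context: The Young diagram of a partition $\lambda=(\lambda_1\geq\lambda_2\geq\dots)$ (a finite sequence of positive integers, extended by zeros) is the set of boxes $(i,j)\in\mathbb{Z}_{\geq 0}^2$ with $0\leq j<\lambda_{i+1}$; it is identified with $\lambda$. For boxes $\Box=(i,j)$, $\Box'=(i',j')$ write $\Box\geq\Box'$ if $i\geq i'$ and $j\geq j'$. $\mathrm{SPP}(\lambda)$ is the set of skew plane partitions of shape $\lambda$: collections $\mathbf{n}=(n_\Box)_{\Box\in\mathbb{Z}_{\geq0}^2\setminus\lambda}$ of nonnegative integers, with only finitely many nonzero entries, such that $n_\Box\leq n_{\Box'}$ whenever $\Box\geq\Box'$. $\mathrm{RPP}(\lambda)$ is the set of reversed plane partitions of shape $\lambda$: collections $\mathbf{n}=(n_\Box)_{\Box\in\lambda}$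 of nonnegative integers such that $n_\Box\leq n_{\Box'}$ whenever $\Box\leq\Box'$. For variables $(q_\Box)_{\Box\in\mathbb{Z}_{\geq0}^2}$ set $\mathbf{q}^{\mathbf{n}}=\prod_\Box q_\Box^{n_\Box}$ (product over the boxes on which $\mathbf{n}$ is defined). The hook at $\Box=(i,j)\in\lambda$ is $H_\lambda(\Box)=\{(l,k)\in\lambda\mid l=i,\,k\geq j\text{ or }l\geq i,\,k=j\}$, and the (external) hook at $\Box=(i,j)\in\mathbb{Z}_{\geq0}^2\setminus\lambda$ is $H_\lambda(\Box)=\{(l,k)\in\mathbb{Z}_{\geq0}^2\setminus\lambda\mid l=i,\,k\leq j\text{ or }l\leq i,\,k=j\}$. For variables $(q_k)_{k\in\mathbb{Z}}$ and a box $\Box\in\mathbb{Z}_{\geq0}^2$ set $$\mathbf{p}_{\Box,\lambda}=\prod_{(i,j)\in H_\lambda(\Box)}q_{j-i}.$$ The identities are between formal power series in the variables $(q_k)_{k\in\mathbb{Z}}$. *)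

(* Defs.v *)
From HB Require Import structures.
From mathcomp Require Import all_boot all_order all_algebra.
From mathcomp Require Import finmap monalg ring.
From mathcomp Require Import boolp classical_sets functions cardinality fsbigop.

Set Implicit Arguments.
Unset Strict Implicit.
Unset Printing Implicit Defensive.

Import Order.TTheory GRing.Theory Num.Theory.

Local Open Scope classical_set_scope.
Local Open Scope ring_scope.

(* A formal power series over R in the variables indexed by I is an arbitrary
   family of coefficients indexed by the monomials {cmonom I}, i.e. by the
   finitely supported functions I -> nat. *)
Record fps (I : choiceType) (R : Type) :=
  FPS { fps_coef :> {cmonom I} -> R }.

HB.instance Definition _ (I : choiceType) (R : Type) := gen_eqMixin (fps I R).
HB.instance Definition _ (I : choiceType) (R : Type) :=
  gen_choiceMixin (fps I R).

Lemma fpsP (I : choiceType) (R : Type) (f g : fps I R) : f =1 g <-> f = g.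
Proof.
by split=> [|->//]; case: f g => [f] [g] /= fg; congr FPS; apply: funext.
Qed.

Section Factorizations.
Variable I : choiceType.
Implicit Types m : {cmonom I}.

Lemma finite_cmonom_le m :
  finite_set [set a : {cmonom I} | forall i, (a i <= m i)%N].
Proof.
pose h (g : {ffun finsupp m -> 'I_(mdeg m).+1}) : {cmonom I} :=
  [cmonom oapp (fun u => val (g u)) 0%N (insub i) | i in finsupp m]%M.
have : finite_set (h @` [set: {ffun finsupp m -> 'I_(mdeg m).+1}]).
  exact/finite_image/finite_finset.
apply: sub_finite_set => a /= le_am.
have le_mdeg i : (m i <= mdeg m)%N.
  have [im|/fsfun_dflt->//] := boolP (i \in finsupp m).
  by rewrite mdegE (big_fsetD1 i im) leq_addr.
exists [ffun i : finsupp m => inord (a (val i))] => //.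
apply/eqP/cmP => i; rewrite /h cmE fsfunE.
case: ifP => [im|/negbT/fsfun_dflt mi0].
  by rewrite insubT /= ffunE inordK // ltnS (leq_trans (le_am _)).
by move: (le_am i); rewrite mi0 leqn0 => /eqP.
Qed.

Lemma finite_factorizations m :
  finite_set [set p : {cmonom I} * {cmonom I} | mmul p.1 p.2 = m].
Proof.
have fm := finite_cmonom_le m.
apply: sub_finite_set (finite_setX fm fm) => -[a b] /= <-.
by split=> i /=; rewrite cmM ?leq_addr ?leq_addl.
Qed.

End Factorizations.

Section Ring.
Variables (I : choiceType) (R : comNzRingType).
Local Notation series := (fps I R).
Implicit Types (f g h : series) (m : {cmonom I}).

Definition fps_zero : series := FPS (fun=> 0).
Definition fps_opp f : series := FPS (fun m => - f m).
Definition fps_add f g : series := FPS (fun m => f m + g m).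

Fact fps_addA : associative fps_add.
Proof. by move=> f g h; apply/fpsP => m /=; rewrite addrA. Qed.
Fact fps_addC : commutative fps_add.
Proof. by move=> f g; apply/fpsP => m /=; rewrite addrC. Qed.
Fact fps_add0 : left_id fps_zero fps_add.
Proof. by move=> f; apply/fpsP => m /=; rewrite add0r. Qed.
Fact fps_addN : left_inverse fps_zero fps_opp fps_add.
Proof. by move=> f; apply/fpsP => m /=; rewrite addNr. Qed.

HB.instance Definition _ := GRing.isZmodule.Build series
  fps_addA fps_addC fps_add0 fps_addN.

Definition fps_mono (a : {cmonom I}) : series := FPS (fun m => (m == a)%:R).

(* The sum ranges over a finite set, by finite_factorizations. *)
Definition fps_mul f g : series := FPS (fun m =>
  \sum_(p \in [set p : {cmonom I} * {cmonom I} | mmul p.1 p.2 = m])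
    f p.1 * g p.2).

(* All sums below are computed over a common finite set of divisors of m. *)
Let V m : {fset {cmonom I}} :=
  fset_set [set a : {cmonom I} | forall i, (a i <= m i)%N].

Let in_V m a : (a \in V m) = `[< forall i, (a i <= m i)%N >].
Proof. by rewrite in_fset_set ?inE //; exact: finite_cmonom_le. Qed.

Let fps_mulE m m' f g : m' \in V m ->
  fps_mul f g m' =
  \sum_(a <- V m) \sum_(b <- V m) (mmul a b == m')%:R * (f a * g b).
Proof.
rewrite in_V => /asboolP le_m /=; have fm := finite_cmonom_le m.
rewrite -fsbig_finite //; under [RHS]eq_fsbigr do rewrite -fsbig_finite //.
rewrite pair_fsbig //=.
transitivity (\sum_(p \in [set p : {cmonom I} * {cmonom I} | mmul p.1 p.2 = m'])
    (mmul p.1 p.2 == m')%:R * (f p.1 * g p.2)).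
  by apply: eq_fsbigr => p; rewrite inE => /= ->; rewrite eqxx mul1r.
apply: fsbig_widen => [[a b] /= abm|[a b] /= [_ /eqP/negPf ->]].
  by split=> i /=; apply: leq_trans (le_m i); rewrite -abm cmM ?leq_addr ?leq_addl.
by rewrite mul0r.
Qed.

Let V_refl m : m \in V m.
Proof. by rewrite in_V; apply/asboolP. Qed.

Let collapse m x a : \sum_(c <- V m) (mmul a c == m)%:R * (x == c)%:R
  = (mmul a x == m)%:R :> R.
Proof.
have [xV|xV] := boolP (x \in V m).
  rewrite (big_fsetD1 x xV) /= eqxx mulr1 big_seq_cond big1 ?addr0 // => c.
  by rewrite !inE andbT eq_sym => /andP[/negPf-> _]; rewrite mulr0.
rewrite big_seq_cond big1 => [|c /[!andbT] cV].
  case: eqP => // axm; case/negP: xV; rewrite in_V -axm.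
  by apply/asboolP => i; rewrite cmM leq_addl.
have /negPf-> : x != c by apply: contraNneq xV => ->.
by rewrite mulr0.
Qed.

Fact fps_mulC : commutative fps_mul.
Proof.
move=> f g; apply/fpsP => m; rewrite !(fps_mulE (m := m)) // exchange_big /=.
by apply: eq_bigr => a _; apply: eq_bigr => b _; rewrite mulmC [f _ * _]mulrC.
Qed.

Let mulA3 f g h m : fps_mul f (fps_mul g h) m =
  \sum_(a <- V m) \sum_(b <- V m) \sum_(d <- V m)
    (mmul a (mmul b d) == m)%:R * (f a * g b * h d).
Proof.
rewrite (fps_mulE (m := m)) //; apply: eq_bigr => a _.
rewrite big_seq_cond.
under eq_bigr => c /[!andbT] cV.
  rewrite (fps_mulE _ _ cV) !mulr_sumr.
  under eq_bigr do rewrite !mulr_sumr.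
  over.
rewrite -big_seq_cond exchange_big /=; apply: eq_bigr => b _.
rewrite exchange_big /=; apply: eq_bigr => d _.
by rewrite -collapse mulr_suml; apply: eq_bigr => c _; ring.
Qed.

Fact fps_mulA : associative fps_mul.
Proof.
move=> f g h; apply/fpsP => m; rewrite [RHS](_ : _ = fps_mul h (fps_mul f g) m);
  last by rewrite [in RHS]fps_mulC.
rewrite !mulA3 [RHS]exchange_big; apply: eq_bigr => a _ /=.
rewrite [RHS]exchange_big; apply: eq_bigr => b _ /=; apply: eq_bigr => d _.
by rewrite mulmA mulmC; congr (_ * _); ring.
Qed.

Fact fps_mul1 : left_id (fps_mono mone) fps_mul.
Proof.
move=> f; apply/fpsP => m; rewrite (fps_mulE (m := m)) //.
have V1 : mone \in V m by rewrite in_V; apply/asboolP => i; rewrite cm1.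
rewrite (big_fsetD1 _ V1) /= [X in _ + X]big_seq_cond [X in _ + X]big1 => [|a];
  last first.
  rewrite andbT in_fsetD1 => /andP[/negPf a1 _].
  by rewrite a1 big1 // => b _; rewrite mul0r mulr0.
rewrite addr0 eqxx (big_fsetD1 m) //= big_seq_cond big1 => [|b].
  by rewrite mul1m eqxx !mul1r addr0.
by rewrite andbT in_fsetD1 mul1m => /andP[/negPf-> _]; rewrite mul0r.
Qed.

Fact fps_mulDl : left_distributive fps_mul fps_add.
Proof.
move=> f g h; apply/fpsP => m /=;
change (fps_mul (fps_add f g) h m = fps_mul f h m + fps_mul g h m).
rewrite !(fps_mulE (m := m)) // -big_split; apply: eq_bigr => a _ /=.
by rewrite -big_split; apply: eq_bigr => b _ /=; ring.
Qed.

Fact fps_1neq0 : fps_mono mone != 0 :> series.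
Proof.
apply/eqP => /(congr1 (fun f : series => f mone)) /= /eqP.
by rewrite eqxx oner_eq0.
Qed.

HB.instance Definition _ := GRing.Zmodule_isComNzRing.Build series
  fps_mulA fps_mulC fps_mul1 fps_mulDl fps_1neq0.

(* Only values at units matter: 1 - f is one whenever f has no constant term
   (fps_unit1B below). *)
Definition fps_unit : pred series := fun f => `[< exists g, g * f = 1 >].
Definition fps_inv f : series :=
  if pselect (exists g, g * f = 1) is left e then projT1 (cid e) else f.

Fact fps_mulVf : {in fps_unit, left_inverse 1 fps_inv *%R}.
Proof.
move=> f /asboolP uf; rewrite /fps_inv; case: pselect => // e.
by case: cid.
Qed.
Fact fps_unitP f g : g * f = 1 -> fps_unit f.
Proof. by move=> gf; apply/asboolP; exists g. Qed.
Fact fps_inv_out : {in [predC fps_unit], fps_inv =1 id}.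
Proof.
move=> f /negP nuf; rewrite /fps_inv; case: pselect => // uf.
by case: nuf; apply/asboolP.
Qed.

HB.instance Definition _ := GRing.ComNzRing_hasMulInverse.Build series
  fps_mulVf fps_unitP fps_inv_out.

Lemma fps_coef0 m : (0 : series) m = 0. Proof. by []. Qed.
Lemma fps_coef1 m : (1 : series) m = (m == mone)%:R. Proof. by []. Qed.
Lemma fps_coefD f g m : (f + g) m = f m + g m. Proof. by []. Qed.
Lemma fps_coefN f m : (- f) m = - f m. Proof. by []. Qed.
Lemma fps_coefM f g m : (f * g) m =
  \sum_(p \in [set p : {cmonom I} * {cmonom I} | mmul p.1 p.2 = m])
    f p.1 * g p.2.
Proof. by []. Qed.

Lemma fps_coef_sum (J : Type) (r : seq J) (P : pred J) (F : J -> series) m :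
  (\sum_(j <- r | P j) F j) m = \sum_(j <- r | P j) F j m.
Proof. by elim/big_rec2: _ => // j x f _ <-. Qed.

Lemma fps_coefM_eq f f' g g' m :
    (forall a b, mmul a b = m -> f a * g b = f' a * g' b) ->
  (f * g) m = (f' * g') m.
Proof.
by move=> e; rewrite !fps_coefM; apply: eq_fsbigr => p /[!inE] /= /e.
Qed.

(* Series without constant term are topologically nilpotent. *)
Lemma fps_coefX_lt f k m : f mone = 0 -> (mdeg m < k)%N -> (f ^+ k) m = 0.
Proof.
move=> f1; elim: k m => // k IHk m; rewrite ltnS => mk.
rewrite exprS fps_coefM fsbig1 // => -[a b] /= abm.
have [->|a1] := eqVneq a mone; first by rewrite f1 mul0r.
rewrite IHk ?mulr0 //; apply: leq_trans mk; rewrite -abm mdegM.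
by rewrite -[ltnLHS]add0n ltn_add2r lt0n mdeg_eq0.
Qed.

Lemma fps_unit1B f : f mone = 0 -> 1 - f \is a GRing.unit.
Proof.
move=> f1; pose g : series := FPS (fun m => \sum_(k < (mdeg m).+1) (f ^+ k) m).
suff gK : g * (1 - f) = 1 by apply/asboolP; exists g.
apply/fpsP => m; rewrite mulrC; pose N := (mdeg m).+1.
rewrite (fps_coefM_eq (f' := 1 - f) (g' := \sum_(k < N) f ^+ k)) => [|a b abm].
  have -> : (1 - f) * (\sum_(k < N) f ^+ k) = 1 - f ^+ N.
    by rewrite -[RHS]opprB subrX1 -mulNr opprB.
  by rewrite fps_coefD fps_coefN [(f ^+ N) m]fps_coefX_lt // subr0.
congr (_ * _); rewrite fps_coef_sum /=.
have le_bN : ((mdeg b).+1 <= N)%N by rewrite ltnS -abm mdegM leq_addl.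
rewrite (big_ord_widen N (fun k => (f ^+ k) b) le_bN) [RHS]big_mkcond /=.
rewrite big_mkcond; apply: eq_bigr => k _; case: ifP => // /negbT.
by rewrite -ltnNge => /fps_coefX_lt ->.
Qed.

End Ring.

Definition fps_var {I : choiceType} {R : comNzRingType} (i : I) : fps I R :=
  fps_mono R (ucm i).

Section Infinite.
Variables (I : choiceType) (R : comNzRingType) (J : choiceType).
Local Notation series := (fps I R).
Implicit Types (D : set J) (F : J -> series) (s : series).

(* The net of series P B, where B ranges over the finite subsets of D ordered
   by inclusion, converges to s coefficientwise (R being discrete). *)
Definition fps_net_cvg D (P : {fset J} -> series) s : Prop :=
  forall m : {cmonom I}, exists2 A : {fset J}, [set` A] `<=` D &
    forall B : {fset J}, (A `<=` B)%fset -> [set` B] `<=` D -> P B m = s m.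

Definition fps_has_sum D F s := fps_net_cvg D (fun B => \sum_(j <- B) F j) s.
Definition fps_has_prod D F s := fps_net_cvg D (fun B => \prod_(j <- B) F j) s.

Lemma fps_net_cvg_unique D (P : {fset J} -> series) s s' :
  fps_net_cvg D P s -> fps_net_cvg D P s' -> s = s'.
Proof.
move=> cs cs'; apply/fpsP => m; have [A AD As] := cs m.
have [B BD Bs] := cs' m.
have ABD : [set` (A `|` B)%fset] `<=` D.
  by move=> j /=; rewrite in_fsetU => /orP[/AD|/BD].
by rewrite -(As _ (fsubsetUl A B) ABD) (Bs _ (fsubsetUr A B) ABD).
Qed.

End Infinite.

(* The parts are listed in weakly decreasing order: la_(i+1) is nth 0 la i. *)
Definition is_partition (la : seq nat) : bool := sorted geq la && (0 \notin la)%N.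

Definition box : Type := (nat * nat)%type.

Definition box_le (b c : box) : bool := (b.1 <= c.1)%N && (b.2 <= c.2)%N.

Definition young (la : seq nat) : {fset box} :=
  [fset b in [seq (i, j) | i <- iota 0 (size la), j <- iota 0 (nth 0 la i)]]%fset.

Lemma in_young la (b : box) : (b \in young la) = (b.2 < nth 0 la b.1)%N.
Proof.
rewrite inE /=; apply/allpairsPdep/idP => [[i [j []]]|].
  by rewrite !mem_iota /= !add0n => _ ? ->.
case: b => i j /= ij; exists i, j; rewrite !mem_iota !add0n /=; split=> //.
by rewrite ltnNge; apply: contraL ij => /(nth_default 0%N)->.
Qed.

Definition inner_hook la (b : box) : {fset box} :=
  [fset c in young la |
    ((c.1 == b.1) && (b.2 <= c.2)%N) || ((b.1 <= c.1)%N && (c.2 == b.2))]%fset.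

Definition outer_hook la (b : box) : {fset box} :=
  [fset c in [seq (l, k) | l <- iota 0 b.1.+1, k <- iota 0 b.2.+1] |
    (c \notin young la) &&
    (((c.1 == b.1) && (c.2 <= b.2)%N) || ((c.1 <= b.1)%N && (c.2 == b.2)))]%fset.

Lemma in_inner_hook la (b c : box) : (c \in inner_hook la b) =
  (c \in young la) &&
  (((c.1 == b.1) && (b.2 <= c.2)%N) || ((b.1 <= c.1)%N && (c.2 == b.2))).
Proof. by rewrite in_fset inE. Qed.

Definition hook la (b : box) : {fset box} :=
  if b \in young la then inner_hook la b else outer_hook la b.

Lemma in_outer_hook la (b c : box) : (c \in outer_hook la b) =
  (c \notin young la) &&
  (((c.1 == b.1) && (c.2 <= b.2)%N) || ((c.1 <= b.1)%N && (c.2 == b.2))).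
Proof.
rewrite in_fset inE; apply/andb_idl => /andP[_ bc].
apply/allpairsPdep; exists c.1, c.2; rewrite !mem_iota !add0n !ltnS -surjective_pairing.
by case/orP: bc => /andP[]; [move=> /eqP-> ->|move=> -> /eqP->]; rewrite leqnn.
Qed.

(* Reversed plane partitions. *)
Definition RPP (la : seq nat) : set {ffun young la -> nat} :=
  [set n | forall b c : young la, box_le (val b) (val c) -> (n b <= n c)%N].

Arguments RPP : clear implicits.

Definition coyoung (la : seq nat) : choiceType := {b : box | b \notin young la}.

(* Skew plane partitions. *)
Definition SPP (la : seq nat) : set {fsfun coyoung la -> nat with 0%N} :=
  [set n | forall b c : coyoung la, box_le (val c) (val b) -> (n b <= n c)%N].

Arguments SPP : clear implicits.

(* The weights are taken with values q b of the box variables in an arbitrary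
   ring A, so that a specialization of the variables is a choice of q. *)
Section Weights.
Variables (A : comNzRingType) (la : seq nat) (q : box -> A).

Definition RPP_weight (n : {ffun young la -> nat}) : A :=
  \prod_(b : young la) q (val b) ^+ n b.

Definition SPP_weight (n : {fsfun coyoung la -> nat with 0%N}) : A :=
  \prod_(b <- finsupp n) q (val b) ^+ n b.

Definition hook_weight (b : box) : A := \prod_(c <- hook la b) q c.

End Weights.

Definition content_var (R : comNzRingType) (b : box) : fps int R :=
  fps_var (b.2%:Z - b.1%:Z).

Lemma hook_refl la (b : box) : b \in hook la b.
Proof.
by rewrite /hook; case: ifP => bla; rewrite (in_inner_hook, in_outer_hook) bla /=
  !eqxx !leqnn.
Qed.

Lemma hook_weight_unit (R : comNzRingType) la (b : box) :
  1 - hook_weight la (content_var R) b \is a GRing.unit.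
Proof.
apply: fps_unit1B; rewrite /hook_weight (big_fsetD1 b (hook_refl la b)).
rewrite fps_coefM fsbig1 // => -[a c] /= /unitm[-> _].
rewrite [_ == _](_ : _ = false) ?mul0r //.
by rewrite eq_sym cm1_eq1.
Qed.

(* Main.v *)
Require Import Defs.
From mathcomp Require Import all_boot all_order all_algebra.
From mathcomp Require Import finmap monalg zify.
From mathcomp Require Import boolp classical_sets functions cardinality fsbigop.

(** Both identities rest on a bijection between reversed plane partitions and
    arbitrary arrays of nonnegative integers of the same shape D, where D is any
    finite order ideal of boxes, that turns the hook of each box into the
    contribution of that box to the diagonal sums.

    The bijection removes one corner c of D at a time. The entries of a reversed
    plane partition n on the diagonal d through c form one partition in a
    sequence of interlacing partitions, and each of them may move freely in the
    interval whose ends are the larger of its upper and left neighbours and the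
    smaller of its right and lower neighbours. Reflecting the entries other than
    the one at c in their intervals ([toggle]) gives a reversed plane partition
    on D without c. At c there is no upper end: the entry is dropped, and its
    excess over the lower end becomes the entry of the array at c. A max and a
    min over the same two neighbours add up to their sum, so the reflection
    replaces the sum along d by the sums along d - 1 and d + 1 minus itself,
    plus the recorded excess ([trace_toggle]).

    Hooks behave alike: a hook meets each diagonal at most once, and for a box
    other than c, the two answers to whether its hook meets d, before and after
    the removal of c, add up to the answers for d - 1 and d + 1
    ([hook_count_on]). Induction then gives the bijection with matching diagonal
    sums ([rpp_hooks]), and the generating series of arrays is a product of
    geometric series ([fps_has_sum_geometric]). This is the first identity, with
    arbitrary weights on the diagonals ([monotone_has_sum]).

    For the second identity, consider the skew plane partitions supported in a
    large square. A half-turn of the square makes them reversed plane partitions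
    on an order ideal, makes external hooks ordinary hooks and negates contents,
    so their series is the finite product over the boxes of the square outside
    the diagram ([SPP_in_has_sum]). A box far from the origin has a long
    external hook, and a skew plane partition that is nonzero at a box is
    nonzero on its whole hook; so neither the missing partitions nor the missing
    factors reach a given coefficient once the square is large enough. *)

Set Implicit Arguments.
Unset Strict Implicit.
Unset Printing Implicit Defensive.

Import Order.TTheory GRing.Theory Num.Theory.

Local Open Scope classical_set_scope.
Local Open Scope ring_scope.

(** * Formal power series up to a given degree *)

Section Series.
Variables (I : choiceType) (R : comNzRingType).
Local Notation series := (fps I R).
Implicit Types (f g : series) (m : {cmonom I}).

Definition eq_below (N : nat) f g : Prop :=
  forall m, (mdeg m < N)%N -> f m = g m.

Lemma eq_belowM N f f' g g' :
  eq_below N f f' -> eq_below N g g' -> eq_below N (f * g) (f' * g').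
Proof.
move=> ff' gg' m mN; apply: fps_coefM_eq => a b abm; rewrite ff' ?gg' //;
  by apply: leq_ltn_trans mN; rewrite -abm mdegM ?leq_addl ?leq_addr.
Qed.

Lemma eq_below_prod N (T : Type) (r : seq T) (P : pred T) (F G : T -> series) :
    (forall i, P i -> eq_below N (F i) (G i)) ->
  eq_below N (\prod_(i <- r | P i) F i) (\prod_(i <- r | P i) G i).
Proof. by move=> FG; elim/big_rec2: _ => // i f g /FG; apply: eq_belowM. Qed.

Lemma eq_below0M N N' f g : eq_below N f 0 -> eq_below N' g 0 ->
  eq_below (N + N') (f * g) 0.
Proof.
move=> f0 g0 m mN; rewrite fps_coefM fsbig1 // => -[a b] /= abm.
have [aN|Na] := ltnP (mdeg a) N; first by rewrite f0 // mul0r.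
by rewrite g0 ?mulr0 //; move: mN; rewrite -abm mdegM; lia.
Qed.

Lemma eq_below0Ml N f g : eq_below N f 0 -> eq_below N (f * g) 0.
Proof.
move=> f0; rewrite -[N]addn0; apply: eq_below0M => // m; by rewrite ltn0.
Qed.

Lemma eq_below_const f : f mone = 0 -> eq_below 1 f 0.
Proof. by move=> f0 m; rewrite ltnS leqn0 mdeg_eq0 => /eqP->. Qed.

Lemma eq_below0_prod (T : eqType) (r : seq T) (F : T -> series) :
  {in r, forall i, F i mone = 0} -> eq_below (size r) (\prod_(i <- r) F i) 0.
Proof.
elim: r => [|i r IHr] F0; [by []|rewrite big_cons /= -add1n].
apply: eq_below0M; first by apply/eq_below_const/F0; rewrite mem_head.
by apply: IHr => j jr; apply: F0; rewrite in_cons jr orbT.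
Qed.

Lemma eq_below0X N k f : f mone = 0 -> (N <= k)%N -> eq_below N (f ^+ k) 0.
Proof. by move=> f0 Nk m mN; apply: fps_coefX_lt => //;
  apply: leq_trans Nk. Qed.

Lemma eq_below_inv1B N f : eq_below N f 0 -> f mone = 0 ->
    eq_below N (1 - f)^-1 1.
Proof.
move=> fN f0 m mN; have u := fps_unit1B f0.
have -> : (1 - f)^-1 = 1 + f * (1 - f)^-1.
  by apply: (mulIr u); rewrite mulrDl mulrVK // mulVr // mul1r subrK.
by rewrite fps_coefD (eq_below0Ml _ fN) // fps_coef0 addr0.
Qed.

(** The remainder of the geometric series after N terms is f ^+ N / (1 - f).
    *)
Lemma eq_below_geometric N f : f mone = 0 ->
  eq_below N (1 - f)^-1 (\sum_(k < N) f ^+ k).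
Proof.
move=> f0 m mN; have u := fps_unit1B f0.
have -> : (1 - f)^-1 = \sum_(k < N) f ^+ k + f ^+ N * (1 - f)^-1.
  apply: (mulIr u); rewrite mulrDl mulrVK // mulVr //.
  have -> : (\sum_(k < N) f ^+ k) * (1 - f) = 1 - f ^+ N.
    by rewrite mulrC -[RHS]opprB subrX1 -mulNr opprB.
  by rewrite subrK.
by rewrite fps_coefD (eq_below0Ml _ (eq_below0X f0 (leqnn N)))
  // fps_coef0 addr0.
Qed.

(** Summability is transported along weight-preserving bijections; the inverse
    e' carries a finite set of indices that suffices for one family to one
    that suffices for the other. *)
Lemma fps_has_sum_bij (J J' : choiceType) (D : set J) (D' : set J')
    (F : J -> series) (F' : J' -> series) (e : J -> J') (e' : J' -> J) s :
    (forall x, D x -> [/\ D' (e x), e' (e x) = x & F x = F' (e x)]) ->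
    (forall y, D' y -> D (e' y) /\ e (e' y) = y) ->
  fps_has_sum D' F' s -> fps_has_sum D F s.
Proof.
move=> eP e'P sF' m; have [A' A'D' A's] := sF' m.
exists [fset e' y | y in A']%fset => [x /imfsetP[y /= yA' ->]|B A'B BD].
  by have [] := e'P y (A'D' y yA').
rewrite -(A's [fset e x | x in B]%fset).
- rewrite /fps_has_sum big_imfset /= => [|x y xB yB exy].
    rewrite big_seq [in RHS]big_seq; congr (fps_coef _ _);
      apply: eq_bigr => x /BD /eP[] //.
  by have [_ <- _] := eP x (BD x xB); have [_ <- _] := eP y (BD y yB);
    rewrite exy.
- apply/fsubsetP => y yA'; have [_ <-] := e'P y (A'D' y yA').
  by apply: in_imfset; apply: (fsubsetP A'B); apply: in_imfset.
- by move=> y /imfsetP[x /= xB ->]; have [] := eP x (BD x xB).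
Qed.

(** Up to degree N, only arrays with all entries below N contribute, and they
    are what the expansion of the product of the truncated geometric series
    yields. *)
Lemma fps_has_sum_geometric (J : finType) (p : J -> series) :
    (forall j, p j mone = 0) ->
  fps_has_sum [set: {ffun J -> nat}] (fun a => \prod_j p j ^+ a j)
    (\prod_j (1 - p j)^-1).
Proof.
move=> p0 m; set N := (mdeg m).+1.
pose h (a : {ffun J -> 'I_N}) : {ffun J -> nat} := [ffun j => a j : nat].
exists [fset h a | a in {: {ffun J -> 'I_N}}]%fset => // B AB _.
rewrite fps_coef_sum -(big_fset_incl _ AB) => [|a _ a_out].
  rewrite big_imfset /= => [|a b _ _ /ffunP ab]; last first.
    by apply/ffunP => j; apply: val_inj; have := ab j; rewrite !ffunE.
  have e := @eq_below_prod N J (index_enum J) xpredT _ _ (fun j _ =>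
    @eq_below_geometric N _ (p0 j)).
  rewrite (e m) // bigA_distr_bigA /= fps_coef_sum big_enum /=.
  apply: eq_bigr => a _; congr (fps_coef _ _); apply: eq_bigr => j _.
  by rewrite ffunE.
have [j Nj] : exists j, (N <= a j)%N.
  apply/existsP; apply: contraNT a_out; rewrite negb_exists => /forallP small.
  have lt j : (a j < N)%N by rewrite ltnNge.
  apply/imfsetP; exists [ffun j => Ordinal (lt j)] => //.
  by apply/ffunP => j; rewrite !ffunE.
rewrite (bigD1 j) //; apply: (@eq_below0Ml N _ _ _ m) => //.
exact: eq_below0X.
Qed.

End Series.

(** * Reflecting a diagonal at a corner *)

Definition content (x : box) : int := x.2%:Z - x.1%:Z.

Definition arm_leg (b x : box) : bool :=
  ((x.1 == b.1) && (b.2 <= x.2)%N) || ((b.1 <= x.1)%N && (x.2 == b.2)).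

Definition order_ideal (D : {fset box}) : Prop :=
  forall x y, box_le x y -> y \in D -> x \in D.

Definition supported (D : {fset box}) (n : box -> nat) : Prop :=
  forall x, x \notin D -> n x = 0%N.

Definition val_up (n : box -> nat) (x : box) : nat :=
  if x.1 is i.+1 then n (i, x.2) else 0%N.
Definition val_left (n : box -> nat) (x : box) : nat :=
  if x.2 is j.+1 then n (x.1, j) else 0%N.

(** [lower] and [upper] are the ends of the interval in which the entry at x
    of a reversed plane partition can move while the others are fixed. Beyond
    the axes the value 0 stands for the absence of a lower bound. Beyond the
    shape the entries are 0 too, so [upper] is 0 at a box with its right or
    lower neighbour outside the shape, where nothing bounds the entry from
    above. *)
Definition lower (n : box -> nat) x := maxn (val_up n x) (val_left n x).
Definition upper (n : box -> nat) (x : box) : nat :=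
  minn (n (x.1, x.2.+1)) (n (x.1.+1, x.2)).

(** The truncated subtraction matters at the corner only: there [upper] is 0
    and the entry is at least [lower], so that the reflected entry is 0 and
    the reflected array vanishes at the corner as it should. *)
Definition toggle (d : int) (n : box -> nat) (x : box) : nat :=
  if content x == d then (lower n x + upper n x - n x)%N else n x.

(** Comparing neighbours only is what a toggle preserves step by step; on an
    order ideal this amounts to monotonicity ([rpp_extend0],
    [monotone_restrict0]). *)
Definition rpp (D : {fset box}) (n : box -> nat) : Prop :=
  supported D n /\ forall x, x \in D -> (lower n x <= n x)%N.

Definition hook_count (D : {fset box}) (b : box) (k : int) : nat :=
  count (fun x => arm_leg b x && (content x == k)) D.

(** Contents are strictly monotone along a hook, so a hook has at most one box
    of each content. *)
Lemma hook_countE D b k x : arm_leg b x -> content x = k ->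
  hook_count D b k = (x \in D).
Proof.
move=> bx <-; rewrite /hook_count -(count_uniq_mem x (fset_uniq D)).
apply: eq_count => y /=; apply/andP/eqP => [[]|->]; last by rewrite eqxx.
move: bx; rewrite /arm_leg /content; case: b x y => [i j] [i' j'] [i'' j''] /=.
by move=> ? ? ?; congr (_, _); lia.
Qed.

Lemma eq_lower (d : int) (n n1 : box -> nat) x :
    (forall y, content y != d -> n1 y = n y) ->
  content x = d -> lower n1 x = lower n x.
Proof.
rewrite /lower /val_up /val_left; case: x => [[|i] [|j]] e xd //=;
  rewrite ?e //.
all: by move: xd; rewrite /content /=; lia.
Qed.

Lemma eq_upper (d : int) (n n1 : box -> nat) (x : box) :
    (forall y, content y != d -> n1 y = n y) ->
  content x = d -> upper n1 x = upper n x.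
Proof.
by move=> e xd; rewrite /upper !e //; move: xd; rewrite /content /=; lia.
Qed.

Definition corner (D : {fset box}) (c : box) : Prop :=
  [/\ order_ideal D, c \in D, (c.1, c.2.+1) \notin D & (c.1.+1, c.2) \notin D].

Section Corner.
Variables (D : {fset box}) (c : box).
Hypothesis cornerDc : corner D c.
Local Notation d := (content c).
Local Notation D' := (D `\ c)%fset.
Implicit Types (n : box -> nat) (x : box).

Let idD : order_ideal D. Proof. by case: cornerDc. Qed.
Let cD : c \in D. Proof. by case: cornerDc. Qed.
Let right_c : (c.1, c.2.+1) \notin D. Proof. by case: cornerDc. Qed.
Let below_c : (c.1.+1, c.2) \notin D. Proof. by case: cornerDc. Qed.

Lemma corner_le1 (x : box) : x \in D -> d <= content x -> (x.1 <= c.1)%N.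
Proof.
move=> xD dx; rewrite leqNgt; apply: contra below_c => lt_cx.
by apply: idD xD; move: lt_cx dx; rewrite /box_le /content /=; lia.
Qed.

Lemma corner_le2 (x : box) : x \in D -> content x <= d -> (x.2 <= c.2)%N.
Proof.
move=> xD dx; rewrite leqNgt; apply: contra right_c => lt_cx.
by apply: idD xD; move: lt_cx dx; rewrite /box_le /content /=; lia.
Qed.

Lemma corner_lt1 (x : box) : x \in D -> d < content x -> (x.1 < c.1)%N.
Proof.
move=> xD dx; rewrite ltnNge; apply: contra right_c => lt_cx.
by apply: idD xD; move: lt_cx dx; rewrite /box_le /content /=; lia.
Qed.

Lemma corner_lt2 (x : box) : x \in D -> content x < d -> (x.2 < c.2)%N.
Proof.
move=> xD dx; rewrite ltnNge; apply: contra below_c => lt_cx.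
by apply: idD xD; move: lt_cx dx; rewrite /box_le /content /=; lia.
Qed.

Lemma le_corner x : box_le x c -> x \in D.
Proof. by move=> /idD; apply. Qed.

Lemma ideal_below_corner : order_ideal D'.
Proof.
move=> x y xy; rewrite !inE => /andP[yc yD]; rewrite (idD xy yD) andbT.
apply: contraNneq yc => xc; move: xy yD; rewrite {x}xc => cy yD.
case: (ltrgtP (content y) d) => yd.
- by have := corner_lt2 yD yd; move: cy; rewrite /box_le; lia.
- by have := corner_lt1 yD yd; move: cy; rewrite /box_le; lia.
have := corner_le2 yD; have := corner_le1 yD;
  rewrite yd lexx => /(_ isT) h1 /(_ isT) h2.
move: cy yd h1 h2; case: (c) (y) => [i j] [i' j'].
by rewrite /box_le /content xpair_eqE /=; lia.
Qed.

Lemma hook_count_corner k : hook_count D c k = (k == d).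
Proof.
case: eqP => [->|kd].
  by rewrite (hook_countE _ (x := c)) ?cD // /arm_leg eqxx leqnn.
apply/eqP; rewrite -leqn0 leqNgt -has_count; apply/hasP => -[x xD].
case/andP=> + /eqP xk; rewrite -xk in kd.
case: (ltrgtP (content x) d) => xd; last by case: kd.
  have := corner_lt2 xD xd; rewrite /arm_leg; lia.
have := corner_lt1 xD xd; rewrite /arm_leg; lia.
Qed.

Lemma hook_count_off b k : k != d -> hook_count D b k = hook_count D' b k.
Proof.
move=> kd; rewrite /hook_count.
have /(seq.permP) -> : perm_eq D (c :: D')%fset.
  apply: uniq_perm => [||x];
    rewrite ?fset_uniq //= ?in_fsetD1 ?eqxx ?fset_uniq //.
  by rewrite !inE; case: eqP => // ->; rewrite cD.
by rewrite /= [d == k]eq_sym (negPf kd) andbF.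
Qed.

(** Diagonals d - 1, d and d + 1 cut a row or a column in consecutive boxes. If
    a line meets d above or left of c, then all three boxes are in D; if it
    meets d below or right of c, then none of them is. On the line of c itself,
    the box on d is c, which is lost, the box before it is in D and the box
    after it is not. *)
Lemma hook_count_on (b : box) : b \in D' ->
  (hook_count D b d + hook_count D' b d =
   hook_count D b (d - 1) + hook_count D b (d + 1))%N.
Proof.
rewrite in_fsetD1 => /andP[bc bD].
(* It suffices to exhibit the boxes x, y and z of the hook of b, in D or not, on
   the diagonals d, d - 1 and d + 1. *)
have count3 (x y z : box) : arm_leg b x && (content x == d) ->
    arm_leg b y && (content y == d - 1) ->
      arm_leg b z && (content z == d + 1) ->
    ((x \in D) + (x \in D') = (y \in D) + (z \in D))%N ->
  (hook_count D b d + hook_count D' b d =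
   hook_count D b (d - 1) + hook_count D b (d + 1))%N.
  move=> /andP[bx /eqP xd] /andP[bY /eqP yd] /andP[bz /eqP zd] e.
  by rewrite !(hook_countE _ bx xd) (hook_countE _ bY yd) (hook_countE _ bz zd).
have [bd|bd|bd] := ltrgtP (content b) d.
- (* The three diagonals cross the arm; j k is the column where d + k does. *)
  pose j k : nat := (b.1 + c.2 + k - c.1)%N.
  have bj : (b.2 + c.1 < b.1 + c.2)%N by move: bd; rewrite /content; lia.
  apply: (count3 (b.1, j 0%N) (b.1, (j 0%N).-1) (b.1, j 1%N));
    rewrite /arm_leg /content /j /= ?in_fsetD1; try lia.
  case: (ltngtP b.1 c.1) => b1.
  + rewrite !le_corner /box_le /=; try lia.
    by case: eqP => // e; move: b1; rewrite -e ltnn.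
  + have out k : (b.1, (j k).-1) \notin D.
      apply: contra below_c; apply: idD; rewrite /box_le /j /=; lia.
    have /negPf-> := out 0%N; have := out 1%N; have := out 2%N.
    rewrite /j.
    rewrite (_ : (_ + 1 - _).-1 = b.1 + c.2 + 0 - c.1)%N; last lia.
    rewrite (_ : (_ + 2 - _).-1 = b.1 + c.2 + 1 - c.1)%N; last lia.
    by move=> /negPf-> /negPf->; rewrite andbF.
  + rewrite (_ : (_ + 0 - _) = c.2)%N; last lia.
    rewrite (_ : (_ + 1 - _) = c.2.+1)%N; last lia.
    rewrite b1 (negPf right_c) -surjective_pairing eqxx cD le_corner //.
    rewrite /box_le /=; lia.
- (* The three diagonals cross the leg; i k is the row where d - k does. *)
  pose i k : nat := (b.2 + c.1 + k - c.2)%N.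
  have bi : (b.1 + c.2 < b.2 + c.1)%N by move: bd; rewrite /content; lia.
  apply: (count3 (i 0%N, b.2) (i 1%N, b.2) ((i 0%N).-1, b.2));
    rewrite /arm_leg /content /i /= ?in_fsetD1; try lia.
  case: (ltngtP b.2 c.2) => b2.
  + rewrite !le_corner /box_le /=; try lia.
    by case: eqP => // e; move: b2; rewrite -e ltnn.
  + have out k : ((i k).-1, b.2) \notin D.
      apply: contra right_c; apply: idD; rewrite /box_le /i /=; lia.
    have /negPf-> := out 0%N; have := out 1%N; have := out 2%N.
    rewrite /i.
    rewrite (_ : (_ + 1 - _).-1 = b.2 + c.1 + 0 - c.2)%N; last lia.
    rewrite (_ : (_ + 2 - _).-1 = b.2 + c.1 + 1 - c.2)%N; last lia.
    by move=> /negPf-> /negPf->; rewrite andbF.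
  + rewrite (_ : (_ + 0 - _) = c.1)%N; last lia.
    rewrite (_ : (_ + 1 - _) = c.1.+1)%N; last lia.
    rewrite b2 (negPf below_c) -surjective_pairing eqxx cD le_corner //.
    rewrite /box_le /=; lia.
(* The box b is on d, strictly before c: its two neighbours are in D. *)
have b1 := corner_le1 bD; have b2 := corner_le2 bD.
have {}b1 : (b.1 <= c.1)%N by apply: b1; rewrite bd.
have {}b2 : (b.2 <= c.2)%N by apply: b2; rewrite bd.
have b_ne : (b.1 != c.1) || (b.2 != c.2).
  rewrite -negb_and; apply: contra bc => /andP[/eqP e1 /eqP e2].
  by rewrite (surjective_pairing b) e1 e2 -surjective_pairing.
apply: (count3 b (b.1.+1, b.2) (b.1, b.2.+1)); rewrite ?in_fsetD1 ?bc ?bD;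
  move: bd b_ne; rewrite /arm_leg /content /=; try lia.
by move=> bd b_ne; rewrite !le_corner /box_le //=; lia.
Qed.

(** The inverse of the toggle. For an array that vanishes at c, [toggle] puts
    there the least value that monotonicity allows, to which t is added. *)
Definition untoggle n (t : nat) x : nat := (toggle d n x + t * (x == c))%N.

(** A box of D next to the diagonal of c, above or left of a box x of the
    diagonal, comes before c, and then so does x. *)
Lemma lower_out n x : supported D n -> content x = d -> x \notin D ->
    lower n x = 0%N.
Proof.
move=> sn; case: x => [i j] xd xD; apply/eqP; rewrite -leqn0 geq_max /=.
apply/andP; split; rewrite leqn0 /val_up /val_left /=.
- case: i xd xD => // i xd xD; apply/eqP/sn.
  apply: contra xD => yD; apply: le_corner.
  have := corner_lt1 yD.
  by move: xd; rewrite /box_le /content /=; lia.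
- case: j xd xD => // j xd xD; apply/eqP/sn.
  apply: contra xD => yD; apply: le_corner.
  have := corner_lt2 yD.
  by move: xd; rewrite /box_le /content /=; lia.
Qed.

Lemma upper_out n x : supported D n -> x \notin D -> upper n x = 0%N.
Proof.
move=> sn xD; rewrite /upper sn ?min0n //.
by apply: contra xD; apply: idD; rewrite /box_le /=; lia.
Qed.

Lemma upper_corner n : supported D n -> upper n c = 0%N.
Proof. by move=> sn; rewrite /upper sn ?min0n. Qed.

(** A box of the diagonal of D other than c precedes c, hence its right and
    lower neighbours are again in D. *)
Lemma le_upper n x : (forall y, y \in D' -> lower n y <= n y)%N ->
  x \in D' -> content x = d -> (n x <= upper n x)%N.
Proof.
move=> len; rewrite in_fsetD1 => /andP[xc xD] xd.
have x1 := corner_le1 xD; have x2 := corner_le2 xD.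
have {}x1 : (x.1 <= c.1)%N by apply: x1; rewrite xd.
have {}x2 : (x.2 <= c.2)%N by apply: x2; rewrite xd.
have x_lt : (x.1 < c.1)%N && (x.2 < c.2)%N.
  move: xd xc x1 x2; case: (c) (x) => [i j] [i' j'].
  by rewrite /content xpair_eqE /=; lia.
rewrite /upper leq_min; apply/andP; split.
- have /len : (x.1, x.2.+1) \in D'.
    rewrite in_fsetD1 le_corner // /box_le /= ?andbT; last by lia.
    by apply: contraTneq isT => e; move: xd; rewrite -e /content /=; lia.
  rewrite /lower /val_left /= -surjective_pairing; lia.
- have /len : (x.1.+1, x.2) \in D'.
    rewrite in_fsetD1 le_corner // /box_le /= ?andbT; last by lia.
    by apply: contraTneq isT => e; move: xd; rewrite -e /content /=; lia.
  rewrite /lower /val_up /= -surjective_pairing; lia.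
Qed.

(** The common part of toggling and untoggling, which differ at c only:
    whatever n1 is at c, reflecting the other entries of the diagonal keeps n1
    monotone away from c. For a box next to the diagonal this holds since the
    reflected neighbour stays below its upper end, which is at most the entry
    of the box. *)
Lemma lower_reflect n n1 : (forall y, y \in D' -> lower n y <= n y)%N ->
    (forall y, content y != d -> n1 y = n y) ->
    (forall y, y \in D' -> content y = d ->
      n1 y = lower n y + upper n y - n y)%N ->
  forall x, x \in D' -> (lower n1 x <= n1 x)%N.
Proof.
move=> len e r x xD'; have [xd|xd] := eqVneq (content x) d.
  rewrite (eq_lower e) // r //; have := le_upper len xD' xd; lia.
have idD' := ideal_below_corner.
rewrite e //; have := len x xD'; rewrite /lower !geq_max => /andP[up_n left_n].
have reflz z : z \in D' -> (n1 z <= maxn (n z) (upper n z))%N.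
  move=> zD'; have [zd|zd] := eqVneq (content z) d; last
    by rewrite e // leq_maxl.
  by rewrite r //; have := len z zD'; lia.
case: x xd xD' up_n left_n => [i j] xd xD'; rewrite /val_up /val_left /= => u l.
apply/andP; split.
- case: i xd xD' u l => // i xd xD' u l.
  have := reflz (i, j) (idD' _ _ _ xD');
    rewrite /box_le /= leqnn leqnSn => /(_ isT).
  by rewrite /upper /=; lia.
- case: j xd xD' u l => // j xd xD' u l.
  have := reflz (i, j) (idD' _ _ _ xD');
    rewrite /box_le /= leqnn leqnSn => /(_ isT).
  by rewrite /upper /=; lia.
Qed.

Lemma supportedD1 n : supported D' n -> supported D n.
Proof. by move=> sn x xD; apply: sn; rewrite in_fsetD1 negb_and xD orbT. Qed.

Lemma supported_toggle n : supported D n -> supported D (toggle d n).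
Proof.
move=> sn x xD; rewrite /toggle; case: eqP => [xd|_]; last exact: sn.
by rewrite lower_out // upper_out.
Qed.

Lemma toggle_off n y : content y != d -> toggle d n y = n y.
Proof. by rewrite /toggle => /negPf->. Qed.

Lemma untoggle_off n t y : content y != d -> untoggle n t y = n y.
Proof.
rewrite /untoggle => yd; rewrite toggle_off //.
have /negPf-> : y != c by apply: contraNneq yd => ->.
by rewrite muln0 addn0.
Qed.

Lemma toggle_on n y : content y = d ->
    toggle d n y = (lower n y + upper n y - n y)%N.
Proof. by move=> e; rewrite /toggle e eqxx. Qed.

Lemma untoggle_on n t y : y != c -> content y = d ->
  untoggle n t y = (lower n y + upper n y - n y)%N.
Proof. by rewrite /untoggle => /negPf-> e;
  rewrite toggle_on // muln0 addn0. Qed.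

Lemma rppD1 n : rpp D n -> forall y, y \in D' -> (lower n y <= n y)%N.
Proof. by move=> [_ len] y; rewrite in_fsetD1 => /andP[_ /len]. Qed.

Lemma toggle_corner n : rpp D n -> toggle d n c = 0%N.
Proof. by move=> [sn len]; rewrite toggle_on // upper_corner //;
  have := len c cD; lia. Qed.

Lemma rpp_toggle n : rpp D n -> rpp D' (toggle d n).
Proof.
move=> rn; split=> [x|].
  rewrite in_fsetD1 negb_and negbK => /orP[/eqP->|]; first exact: toggle_corner.
  by apply: supported_toggle; case: rn.
apply: lower_reflect (rppD1 rn) _ _ => y; first exact: toggle_off.
by move=> _; apply: toggle_on.
Qed.

Lemma untoggle_corner n t : rpp D' n -> untoggle n t c = (lower n c + t)%N.
Proof.
move=> [sn _]; rewrite /untoggle toggle_on // upper_corner;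
  last exact: supportedD1.
by rewrite sn ?in_fsetD1 eqxx //; lia.
Qed.

Lemma rpp_untoggle n t : rpp D' n -> rpp D (untoggle n t).
Proof.
move=> rn; split=> [x xD|x xD].
  rewrite /untoggle supported_toggle //; last by apply: supportedD1; case: rn.
  by case: eqP xD => [->|]; rewrite ?cD // muln0.
have [->|xc] := eqVneq x c.
  rewrite untoggle_corner // (@eq_lower d n) //; first by lia.
  by move=> y; apply: untoggle_off.
have xD' : x \in D' by rewrite in_fsetD1 xc.
apply: lower_reflect xD'; first by case: rn => _ ; apply.
  by move=> y; apply: untoggle_off.
by move=> y; rewrite in_fsetD1 => /andP[yc _]; apply: untoggle_on.
Qed.

Lemma toggleD n x : rpp D n -> content x = d ->
  (n x + toggle d n x =
   (x == c) * (n c - lower n c) + (lower n x + upper n x))%N.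
Proof.
move=> rn xd; have [sn len] := rn; have [->|xc] := eqVneq x c.
  by rewrite toggle_corner // upper_corner //; have := len c cD; lia.
rewrite toggle_on //; have [xD|xD] := boolP (x \in D).
  by have := @le_upper n x (rppD1 rn) _ xd; rewrite in_fsetD1 xc => /(_ xD);
    lia.
by rewrite sn // lower_out ?upper_out.
Qed.

Lemma untoggleK n t : rpp D' n -> toggle d (untoggle n t) = n.
Proof.
move=> rn; have [sn len] := rn; apply: funext => x.
have [xd|xd] := eqVneq (content x) d; last by rewrite toggle_off ?untoggle_off.
have off y : content y != d -> untoggle n t y = n y by apply: untoggle_off.
rewrite toggle_on // (eq_lower off) // (eq_upper off) //.
have [->|xc] := eqVneq x c.
  rewrite untoggle_corner // upper_corner; last exact: supportedD1.
  by rewrite sn ?in_fsetD1 ?eqxx //; lia.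
rewrite untoggle_on //; have [xD|xD] := boolP (x \in D).
  by have := @le_upper n x len _ xd; rewrite in_fsetD1 xc => /(_ xD); lia.
rewrite lower_out ?upper_out //; try exact: supportedD1.
by rewrite (supportedD1 sn).
Qed.

Lemma toggleK n : rpp D n -> untoggle (toggle d n) (n c - lower n c) = n.
Proof.
move=> rn; have [sn len] := rn; apply: funext => x.
have [xd|xd] := eqVneq (content x) d; last by rewrite untoggle_off ?toggle_off.
have off y : content y != d -> toggle d n y = n y by apply: toggle_off.
have [->|xc] := eqVneq x c.
  rewrite untoggle_corner; last exact: rpp_toggle.
  by rewrite (eq_lower off) //; have := len c cD; lia.
rewrite untoggle_on // (eq_lower off) // (eq_upper off) // toggle_on //.
have [xD|xD] := boolP (x \in D).
  by have := @le_upper n x (rppD1 rn) _ xd; rewrite in_fsetD1 xc => /(_ xD);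
    lia.
by rewrite lower_out ?upper_out // sn.
Qed.

End Corner.

(** * Diagonal sums and the bijection *)

(** Summing over a whole square instead of over D lets the shifts by one box
    be performed freely; the extra row and column absorb the shifts. *)
Definition trace (N : nat) (k : int) (n : box -> nat) : nat :=
  (\sum_(i < N.+1) \sum_(j < N.+1)
     (content (i : nat, j : nat) == k) * n (i : nat, j : nat))%N.

Lemma sum_shift (N : nat) (F : nat -> nat) : F 0%N = 0%N -> F N = 0%N ->
  (\sum_(i < N) F i.+1 = \sum_(i < N) F i)%N.
Proof.
move=> F0 FN; have := @big_ord_recr _ 0%N addn N (fun i => F i).
by rewrite big_ord_recl /= F0 FN add0n addn0.
Qed.

Definition bounded (N : nat) (D : {fset box}) : Prop :=
  forall x, x \in D -> (x.1 < N)%N && (x.2 < N)%N.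

Lemma exists_bounded D : exists N, bounded N D.
Proof.
exists (\max_(x <- D) (maxn x.1 x.2).+1)%N => x xD.
have := @leq_bigmax_seq _ (enum_fset D) xpredT (fun x : box =>
  (maxn x.1 x.2).+1) x xD isT.
by rewrite gtn_max.
Qed.

Lemma sum_square N D (F : box -> nat) : bounded N D -> supported D F ->
  (\sum_(x <- D) F x = \sum_(i < N) \sum_(j < N) F (i : nat, j : nat))%N.
Proof.
move=> DN F0.
pose sq := [seq (i, j) | i <- iota 0 N, j <- iota 0 N].
have -> : (\sum_(x <- D) F x = \sum_(x <- sq | x \in D) F x)%N.
  rewrite -[RHS]big_filter; apply: perm_big; apply: uniq_perm;
    first exact: fset_uniq.
    rewrite filter_uniq // allpairs_uniq ?iota_uniq //.
    by move=> [? ?] [? ?] _ _ /= [-> ->].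
  move=> x; rewrite mem_filter; apply/idP/andP => [xD|[]//]; split=> //.
  have /andP[x1 x2] := DN x xD; apply/allpairsP; exists x.
  by rewrite !mem_iota /= x1 x2 -surjective_pairing.
rewrite big_mkcond big_allpairs_dep /= -(big_mkord xpredT (fun i =>
  \sum_(j < N) F (i, j : nat))%N).
rewrite /index_iota subn0; apply: eq_bigr => i _.
rewrite -(big_mkord xpredT (fun j => F (i, j))) /index_iota subn0.
by apply: eq_bigr => j _; case: ifP => // /negbT /F0.
Qed.

(** Sum [toggleD] over the diagonal. Shifting by (1, 1) turns the sum of the
    [upper] ends into the sum of the minima over the upper and left
    neighbours, which together with the [lower] ends gives all upper and left
    neighbours of the diagonal, that is all entries of the diagonals d + 1 and
    d - 1. *)
Lemma trace_toggle D c N n : corner D c -> rpp D n ->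
    bounded N D ->
  (trace N (content c) n + trace N (content c) (toggle (content c) n) =
   n c - lower n c + trace N (content c - 1) n + trace N (content c + 1) n)%N.
Proof.
move=> cDc rn DN; have [sn len] := rn; set d := content c.
have [_ cD _ _] := cDc.
have nN i j : (N <= i)%N || (N <= j)%N -> n (i, j) = 0%N.
  by move=> ij; apply: sn; apply/negP => /DN /=; lia.
have upN j : val_up n (N.+1, j) = 0%N by rewrite /val_up /= nN ?leqnn.
have leftN i : val_left n (i, N.+1) = 0%N
  by rewrite /val_left /= nN ?leqnn ?orbT.
pose low_min x := minn (val_up n x) (val_left n x).
have tr_d1 : trace N (d + 1) n = trace N d (val_up n).
  pose F i := (\sum_(j < N.+1) (content (i, j : nat) == d)
    * val_up n (i, j : nat))%N.
  rewrite /trace -(sum_shift (F := F)) /F; first last.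
  - by rewrite big1 // => j _; rewrite upN muln0.
  - by rewrite big1 // => j _; rewrite /val_up muln0.
  apply: eq_bigr => i _; apply: eq_bigr => j _; rewrite /val_up /=;
    congr (_ * _)%N.
  by rewrite /content /=; lia.
have tr_d2 : trace N (d - 1) n = trace N d (val_left n).
  rewrite /trace; apply: eq_bigr => i _.
  pose F j := ((content (i : nat, j) == d) * val_left n (i : nat, j))%N.
  rewrite -(sum_shift (F := F)) /F; first last.
  - by rewrite leftN muln0.
  - by rewrite /val_left muln0.
  apply: eq_bigr => j _; rewrite /val_left /=; congr (_ * _)%N.
  by rewrite /content /=; lia.
have tr_up : trace N d (upper n) = trace N d low_min.
  pose F i := (\sum_(j < N.+1) (content (i, j : nat) == d)
    * low_min (i, j : nat))%N.
  rewrite /trace -(sum_shift (F := F)) /F; first last.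
  - by rewrite big1 // => j _; rewrite /low_min upN min0n muln0.
  - by rewrite big1 // => j _; rewrite /low_min min0n muln0.
  apply: eq_bigr => i _; pose G j :=
    ((content (i.+1, j) == d) * low_min (i.+1, j))%N.
  rewrite -(sum_shift (F := G)) /G; first last.
  - by rewrite /low_min leftN minn0 muln0.
  - by rewrite /low_min minn0 muln0.
  apply: eq_bigr => j _; rewrite /low_min /upper /val_left /val_up /= minnC.
  by congr (_ * _)%N; rewrite /content /=; lia.
have tr_c : trace N d (fun x =>
  (x == c) * (n c - lower n c))%N = (n c - lower n c)%N.
  rewrite /trace -(sum_square (D := [fset c]%fset) (N := N.+1)
     (F := fun x => (content x == d) * ((x == c) * (n c - lower n c)))%N).
  - by rewrite big_seq_fset1 /d !eqxx !mul1n.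
  - move=> x /fset1P->; case: (c) cD => i j ijD /=.
    by have /andP[/= /ltnW iN /ltnW jN] := DN _ ijD; rewrite !ltnS iN.
  - by move=> x; rewrite inE => /negPf->; rewrite muln0.
(* Adding the sum of the upper ends on both sides, as tr_up on the left, makes
   the identity hold box by box. *)
rewrite tr_d1 tr_d2 -tr_c; apply: (@addIn (trace N d (upper n))).
rewrite [in LHS]tr_up /trace -!big_split; apply: eq_bigr => i _.
rewrite -!big_split; apply: eq_bigr => j _ /=.
case: eqP => [xd|]; last by rewrite !mul0n.
rewrite !mul1n (toggleD cDc) // /low_min /lower; lia.
Qed.

Lemma exists_corner D : order_ideal D -> D != fset0 -> exists c, corner D c.
Proof.
move=> idD /fset0Pn[x0 x0D].
pose r (x : D) := ((val x).1 + (val x).2)%N.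
case: (@arg_maxnP _ (FSetSub x0D) xpredT r) => // c _ max_c.
exists (val c); split=> //; first exact: valP.
- by apply/negP => yD; have := max_c (FSetSub yD) isT; rewrite /r /=; lia.
- by apply/negP => yD; have := max_c (FSetSub yD) isT; rewrite /r /=; lia.
Qed.

Lemma trace_off N c n k : k != content c ->
    trace N k (toggle (content c) n) = trace N k n.
Proof.
move=> kc; apply: eq_bigr => i _; apply: eq_bigr => j _.
by case: eqP => // e; rewrite /toggle e (negPf kc).
Qed.

(** The sum along the k-th diagonal that results from counting the hook of
    each box b with multiplicity a b. *)
Definition hook_trace (D : {fset box}) (k : int) (a : box -> nat) : nat :=
  (\sum_(b <- D) a b * hook_count D b k)%N.

Lemma hook_trace_off D c k a : corner D c -> k != content c ->
  hook_trace D k a = hook_trace (D `\ c)%fset k a.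
Proof.
move=> cDc kc; have [_ cD _ _] := cDc.
rewrite /hook_trace (big_fsetD1 c cD) /= (hook_count_corner cDc) (negPf kc)
  muln0 add0n.
by apply: eq_bigr => b _; rewrite (hook_count_off cDc).
Qed.

Lemma hook_trace_on D c a : corner D c ->
  let d := content c in let D' := (D `\ c)%fset in
  (hook_trace D d a + hook_trace D' d a =
   a c + hook_trace D' (d - 1) a + hook_trace D' (d + 1) a)%N.
Proof.
move=> cDc d D'; have [_ cD _ _] := cDc.
rewrite /hook_trace (big_fsetD1 c cD) /= (hook_count_corner cDc) eqxx muln1.
rewrite -!addnA -!big_split /=; congr (_ + _)%N; rewrite big_seq [RHS]big_seq.
apply: eq_bigr => b bD'; rewrite -!mulnDr (hook_count_on cDc bD').
by rewrite !(hook_count_off cDc) //; rewrite /d; lia.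
Qed.

(** Induction on D: a box of D with the largest sum of coordinates is a
    corner; toggle its diagonal, store the excess at the corner and go on with
    the rest of D. The recursions [trace_toggle] and [hook_trace_on] agree. *)
Lemma rpp_hooks N D : order_ideal D ->
    bounded N D ->
  exists f g : (box -> nat) -> (box -> nat),
    (forall n, rpp D n -> [/\ supported D (f n), g (f n) = n &
       forall k, trace N k n = hook_trace D k (f n)]) /\
    (forall a, supported D a -> rpp D (g a) /\ f (g a) = a).
Proof.
elim: {D}_.+1 {-2}D (ltnSn #|` D|) => // m IHm D; rewrite ltnS => Dm idD DN.
have [D0|/(exists_corner idD)[c cDc]] := eqVneq D fset0.
  have out x : x \notin D by rewrite D0.
  have sup0 a : supported D a -> a = fun=> 0%N
    by move=> sa; apply: funext => x; apply: sa.
  exists id, id; split=> [n [sn _]|a sa]; last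
    by split=> //; split=> // x; rewrite D0.
  split=> // k; rewrite (sup0 n sn) /trace /hook_trace big1 => [|i _];
    last first.
    by rewrite big1 // => j _; rewrite muln0.
  by rewrite big1_seq.
have [_ cD _ _] := cDc.
have D'm : (#|` (D `\ c)%fset| < m)%N by rewrite (cardfsD1 c D) cD in Dm.
have D'N : bounded N (D `\ c)%fset.
  by move=> x /fsetD1P[_ /DN].
have [f [g [fP gP]]] := IHm _ D'm (ideal_below_corner cDc) D'N.
pose F n x := if x == c then (n c - lower n c)%N else f (toggle (content c) n)
  x.
pose rest (a : box -> nat) x := if x == c then 0%N else a x.
pose G a := untoggle c (g (rest a)) (a c).
have supD' a x : supported (D `\ c)%fset a -> x == c -> a x = 0%N.
  by move=> sa /eqP->; apply: sa; rewrite !inE eqxx.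
have restF n : rpp D n -> rest (F n) = f (toggle (content c) n).
  move=> /(rpp_toggle cDc)/fP[sf _ _]; apply: funext => x; rewrite /rest /F.
  by case: eqP => // /eqP /(supD' _ _ sf).
exists F, G; split=> [n rn|a sa].
  have [sf gf tr] := fP _ (rpp_toggle cDc rn); split.
  - move=> x xD; rewrite /F; case: eqP xD => [->|_ xD]; first by rewrite cD.
    by apply: sf; rewrite inE (negPf xD) andbF.
  - by rewrite /G restF // gf /F eqxx (toggleK cDc).
  have hF k : hook_trace (D `\ c)%fset k (F n) =
    trace N k (toggle (content c) n).
    rewrite tr /hook_trace big_seq [RHS]big_seq; apply: eq_bigr => b.
    by rewrite /F !inE => /andP[/negPf->].
  move=> k; have [->|kd] := eqVneq k (content c); last first.
    by rewrite (hook_trace_off _ cDc) // hF trace_off.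
  have := hook_trace_on (F n) cDc;
    rewrite /= !hF !(@trace_off _ _ _ (content c + _)); try lia.
  have -> : F n c = (n c - lower n c)%N by rewrite /F eqxx.
  by have := trace_toggle cDc rn DN; lia.
have sr : supported (D `\ c)%fset (rest a).
  by move=> x; rewrite !inE /rest; case: eqP => //= _; apply: sa.
have [rg fg] := gP _ sr; split; first exact: rpp_untoggle.
apply: funext => x; rewrite /F (untoggleK cDc) // fg /rest; case: eqP => // ->.
rewrite /G (untoggle_corner cDc) // (@eq_lower (content c) (g (rest a))) //;
  first lia.
by move=> y; apply: untoggle_off.
Qed.

(** * The series of reversed plane partitions on an order ideal *)

Lemma prod_by_content (A : comNzRingType) (q : int -> A) (s : seq box)
    (P : pred box) (F : box -> nat) (K : seq int) :
    uniq K -> {in s, forall x, content x \in K} ->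
  \prod_(x <- s | P x) q (content x) ^+ F x =
  \prod_(k <- K) q k ^+ (\sum_(x <- s | P x) (content x == k) * F x)%N.
Proof.
move=> uK sK; under [RHS]eq_bigr do rewrite -prodrXr.
rewrite exchange_big /= big_seq_cond [RHS]big_seq_cond.
apply: eq_bigr => x /andP[/sK xK _]; rewrite (bigD1_seq _ xK uK) /= eqxx mul1n.
by rewrite big1 ?mulr1 // => k /negPf; rewrite eq_sym => ->;
  rewrite mul0n expr0.
Qed.

Definition ideal_hook (D : {fset box}) (b : box) : {fset box} :=
  [fset x in D | arm_leg b x]%fset.

(** A weight that depends on the content only is determined by the sums along
    the diagonals. *)
Lemma weight_hook_trace (A : comNzRingType) (q : int -> A) N D n a :
    bounded N D -> supported D n ->
    (forall k, trace N k n = hook_trace D k a) ->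
  \prod_(x <- D) q (content x) ^+ n x =
  \prod_(b <- D) (\prod_(x <- ideal_hook D b) q (content x)) ^+ a b.
Proof.
move=> DN sn tr; pose K := undup [seq content x | x <- enum_fset D].
have uK : uniq K by apply: undup_uniq.
have DK : {in D, forall x, content x \in K}.
  by move=> x xD; rewrite mem_undup; apply: map_f.
have hook_b b : \prod_(x <- ideal_hook D b) q (content x) =
    \prod_(k <- K) q k ^+ hook_count D b k.
  rewrite big_fset /= -[LHS](eq_bigr _ (fun x _ => expr1 (q (content x)))).
  rewrite (prod_by_content _ _ (fun=> 1%N) uK DK); apply: eq_bigr => k _.
  congr (_ ^+ _); rewrite /hook_count -sum1_count [in RHS]big_mkcond.
  rewrite [LHS]big_mkcond; apply: eq_bigr => x _ /=.
  by case: arm_leg; case: eqP.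
rewrite (prod_by_content _ _ _ uK DK).
under [RHS]eq_bigr => b _.
  rewrite hook_b -prodrXl.
  under eq_bigr do rewrite -exprM mulnC.
  over.
rewrite exchange_big /=; apply: eq_bigr => k _; rewrite prodrXr; congr (_ ^+ _).
rewrite -[RHS]tr; apply: sum_square => [x|x xD]; last by rewrite sn ?muln0.
by move=> /DN/andP[/ltnW x1 /ltnW x2]; rewrite !ltnS x1.
Qed.

Definition extend0 (D : {fset box}) (n : {ffun D -> nat}) (x : box) : nat :=
  if insub x is Some u then n u else 0%N.
Definition restrict0 (D : {fset box}) (n : box -> nat) : {ffun D -> nat} :=
  [ffun u => n (val u)].

Lemma extend0_val (D : {fset box}) (n : {ffun D -> nat}) u :
    extend0 n (val u) = n u.
Proof. by rewrite /extend0 valK. Qed.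

Lemma supported_extend0 (D : {fset box}) (n : {ffun D -> nat}) :
    supported D (extend0 n).
Proof. by move=> x xD; rewrite /extend0 insubN. Qed.

Lemma extend0K D : cancel (@extend0 D) (@restrict0 D).
Proof. by move=> n; apply/ffunP => u; rewrite ffunE extend0_val. Qed.

Lemma restrict0K D n : supported D n -> extend0 (restrict0 D n) = n.
Proof.
move=> sn; apply: funext => x; rewrite /extend0;
  case: insubP => [u _ <-|/sn //].
by rewrite ffunE.
Qed.

Definition monotone (D : {fset box}) : set {ffun D -> nat} :=
  [set n | forall b c : D, box_le (val b) (val c) -> (n b <= n c)%N].

Lemma rpp_extend0 (D : {fset box}) (n : {ffun D -> nat}) :
    order_ideal D -> monotone n -> rpp D (extend0 n).
Proof.
move=> idD mn; split=> [|x xD]; first exact: supported_extend0.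
have le y : box_le y x -> (extend0 n y <= extend0 n x)%N.
  move=> yx; rewrite -[x]/(val [` xD]%fset) -[y]/(val [` idD _ _ yx xD]%fset).
  by rewrite !extend0_val; apply: mn.
rewrite geq_max /val_up /val_left; case: x xD le => [[|i] [|j]] xD le /=.
all: by rewrite ?le // /box_le /= ?leqnn ?leqnSn.
Qed.

Lemma monotone_restrict0 D n :
    order_ideal D -> rpp D n -> monotone (restrict0 D n).
Proof.
move=> idD [sn len] b c; rewrite !ffunE.
have : val c \in D := valP c.
case: (val b) (val c) => [i j] [i' j'] cD /andP[/= ii' jj'].
rewrite -(subnKC ii') -(subnKC jj') in cD *.
elim: (i' - i)%N cD => [|k IHk].
  elim: (j' - j)%N => [|l IHl]; rewrite !addn0 // !addnS => lD.
  have := len _ lD; rewrite geq_max /val_left /= => /andP[_]; apply: leq_trans.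
  rewrite -[i in leqRHS]addn0; apply: IHl; apply: idD lD.
  by rewrite /box_le /= addn0 leqnn leqnSn.
rewrite addnS => kD; have := len _ kD; rewrite geq_max /val_up /= => /andP[+ _].
apply: leq_trans; apply: IHk; apply: idD kD.
by rewrite /box_le /= leqnn leqnSn.
Qed.

Lemma prod_extend0 (A : comNzRingType) (D : {fset box}) (F : box -> A)
    (n : {ffun D -> nat}) :
  \prod_(u : D) F (val u) ^+ n u = \prod_(x <- D) F x ^+ extend0 n x.
Proof. by rewrite big_seq_fsetE /=; apply: eq_bigr => u _;
  rewrite extend0_val. Qed.

(** The hook formula for an arbitrary order ideal and arbitrary series without
    constant term as weights of the diagonals. *)
Lemma monotone_has_sum (I : choiceType) (R : comNzRingType)
    (q : int -> fps I R) D :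
    order_ideal D -> (forall k, q k mone = 0) ->
  fps_has_sum (@monotone D) (fun n => \prod_(u : D) q (content (val u)) ^+ n u)
    (\prod_(b <- D) (1 - \prod_(x <- ideal_hook D b) q (content x))^-1).
Proof.
move=> idD q0; have [N DN] := exists_bounded D.
have [f [g [fP gP]]] := rpp_hooks idD DN.
pose p (b : box) := \prod_(x <- ideal_hook D b) q (content x).
have p0 (b : D) : p (val b) mone = 0.
  have bb : val b \in ideal_hook D (val b).
    by rewrite !inE /arm_leg !eqxx leqnn ?andbT ?(valP b) /=.
  rewrite /p (big_fsetD1 _ bb) /=.
  by apply: (eq_below0Ml _ (eq_below_const (q0 _))); rewrite mdeg1.
rewrite big_seq_fsetE /=.
apply: (@fps_has_sum_bij _ _ _ _ _ _ _ _ (fun n => restrict0 D (f (extend0 n)))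
  (fun a => restrict0 D (g (extend0 a))) _ _ _ (fps_has_sum_geometric p0)).
- move=> n mn; have [sf gf tr] := fP _ (rpp_extend0 idD mn); split=> //.
    by rewrite restrict0K // gf extend0K.
  rewrite (prod_extend0 (fun x =>
    q (content x))) (prod_extend0 p) restrict0K //.
  by apply: weight_hook_trace DN _ tr; apply: supported_extend0.
- move=> a _; have [rg fg] := gP _ (@supported_extend0 D a).
  by split; [exact: monotone_restrict0|rewrite restrict0K ?fg ?extend0K //;
    case: rg].
Qed.

(** * Partitions, their complements and the half-turn *)

Lemma content_var_const (R : comNzRingType) b : content_var R b mone = 0.
Proof. by rewrite /content_var /= eq_sym cm1_eq1. Qed.

Section Shape.
Variables (R : comNzRingType) (la : seq nat).
Hypothesis la_partition : is_partition la.
Local Notation hookw := (hook_weight la (content_var R)).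

Lemma nth_partition i j : (i <= j)%N -> (nth 0%N la j <= nth 0%N la i)%N.
Proof.
move=> ij; have [jl|lj] := ltnP j (size la); last by rewrite (nth_default _ lj).
have /andP[srt _] := la_partition.
apply: (sorted_leq_nth (leT := geq)) => //=.
- by move=> a b c /= ab bc; apply: leq_trans ab.
- by move=> a /=.
- by rewrite inE (leq_ltn_trans ij).
Qed.

Lemma young_ideal : order_ideal (young la).
Proof.
move=> x y /andP[x1 x2]; rewrite !in_young => /(leq_ltn_trans x2) lt.
exact: leq_trans lt (nth_partition x1).
Qed.

Lemma RPP_has_sum :
  fps_has_sum (RPP la) (fun n => RPP_weight (content_var R) n)
    (\prod_(b <- young la) (1 - hookw b)^-1).
Proof.
have q0 (k : int) : (fps_var k : fps int R) mone = 0
  by rewrite /= eq_sym cm1_eq1.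
suff -> : \prod_(b <- young la) (1 - hookw b)^-1 = \prod_(b <- young la)
    (1 - \prod_(x <- ideal_hook (young la) b) fps_var (content x))^-1.
  exact: monotone_has_sum young_ideal q0.
apply: eq_big_seq => b bla; congr (1 - _)^-1.
by rewrite /hook_weight /hook bla.
Qed.

(** Below the last row of the diagram, every box of the column of b down to b
    is in the external hook. *)
Lemma lt_hook1 (b : box) : b \notin young la ->
    (b.1 < #|` hook la b| + size la)%N.
Proof.
move=> bla; rewrite /hook (negPf bla).
pose A := [fset (l, b.2) | l in iota (size la) (b.1.+1 - size la)]%fset.
have : (#|` A| <= #|` outer_hook la b|)%N.
  apply: fsubset_leq_card; apply/fsubsetP => x /imfsetP[l /=].
  rewrite mem_iota => lP ->; rewrite in_outer_hook in_young /= eqxx.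
  by rewrite nth_default; lia.
rewrite card_imfset /= => [|i j [] //];
  rewrite undup_id ?iota_uniq // size_iota.
lia.
Qed.

(** Beyond the longest row of the diagram, every box of the row of b up to b
    is in the external hook. *)
Lemma lt_hook2 (b : box) : b \notin young la ->
    (b.2 < #|` hook la b| + nth 0%N la 0%N)%N.
Proof.
move=> bla; rewrite /hook (negPf bla).
pose A := [fset (b.1, k) | k in iota (nth 0%N la 0%N)%N (b.2.+1 - nth 0%N la
  0%N)]%fset.
have : (#|` A| <= #|` outer_hook la b|)%N.
  apply: fsubset_leq_card; apply/fsubsetP => x /imfsetP[k /=].
  rewrite mem_iota => kP ->; rewrite in_outer_hook in_young /= eqxx.
  by have := nth_partition (leq0n b.1); lia.
rewrite card_imfset /= => [|i j [] //];
  rewrite undup_id ?iota_uniq // size_iota.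
lia.
Qed.

Definition square (N : nat) : {fset box} :=
  [fset b in [seq (i, j) | i <- iota 0 N, j <- iota 0 N]]%fset.

Lemma in_square N (x : box) : (x \in square N) = (x.1 < N)%N && (x.2 < N)%N.
Proof.
rewrite inE; apply/allpairsP/andP => [[y []]|[x1 x2]].
  by rewrite !mem_iota /= !add0n => ? ? ->.
by exists x; rewrite !mem_iota /= x1 x2 -surjective_pairing.
Qed.

Definition half_turn (N : nat) (x : box) : box := (N.-1 - x.1, N.-1 - x.2)%N.

Lemma half_turn_square N x : x \in square N -> half_turn N x \in square N.
Proof. by rewrite !in_square /half_turn /=; lia. Qed.

Lemma half_turnK N : {in square N, involutive (half_turn N)}.
Proof.
move=> [i j]; rewrite in_square /half_turn /= => ij; congr (_, _); lia.
Qed.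

Lemma half_turn_inj N : {in square N &, injective (half_turn N)}.
Proof. by move=> x y xN yN e; rewrite -(half_turnK xN) e half_turnK. Qed.

Lemma half_turn_le N x y : box_le x y -> box_le (half_turn N y) (half_turn N x).
Proof. by rewrite /box_le /half_turn /=; lia. Qed.

Lemma content_half_turn N x :
    x \in square N -> content (half_turn N x) = - content x.
Proof. by rewrite in_square /content /half_turn /=; lia. Qed.

Definition outside (N : nat) : {fset box} :=
    [fset x in square N | x \notin young la]%fset.

(** The image of [outside N] under the half-turn. *)
Definition turned (N : nat) : {fset box} :=
  [fset x in square N | half_turn N x \notin young la]%fset.

Lemma in_outside N x : (x \in outside N) =
    (x \in square N) && (x \notin young la).
Proof. by rewrite in_fset inE. Qed.

Lemma in_turned N x : (x \in turned N) =
    (x \in square N) && (half_turn N x \notin young la).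
Proof. by rewrite in_fset inE. Qed.

Lemma in_hook_turned N b x :
  (x \in ideal_hook (turned N) b) = (x \in turned N) && arm_leg b x.
Proof. by rewrite in_fset inE. Qed.

(** The half-turn reverses the order, and the complement of the diagram is
    closed under going up. *)
Lemma turned_ideal N : order_ideal (turned N).
Proof.
move=> x y xy; rewrite !in_turned => /andP[yN ry]; apply/andP; split.
  by move: yN xy; rewrite !in_square /box_le; lia.
by apply: contra ry; apply: young_ideal; apply: half_turn_le.
Qed.

Lemma prod_turned (A : comNzRingType) N (F : box -> A) :
  \prod_(x <- outside N) F x = \prod_(x <- turned N) F (half_turn N x).
Proof.
have -> : outside N = [fset half_turn N x | x in turned N]%fset.
  apply/fsetP => x; rewrite in_outside; apply/andP/imfsetP => /= [[xN xla]|[y]].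
    by exists (half_turn N x);
      rewrite /= ?in_turned half_turnK ?xla ?half_turn_square.
  by rewrite in_turned => /andP[yN ry] ->; rewrite half_turn_square.
rewrite big_imfset //= => x y; rewrite !in_turned => /andP[xN _] /andP[yN _];
  exact: half_turn_inj.
Qed.

Lemma hook_turned N b : b \in turned N ->
  hookw (half_turn N b) = \prod_(x <- ideal_hook (turned N) b)
    fps_var (- content x).
Proof.
have hook_square x : x \in ideal_hook (turned N) b -> x \in square N.
  by rewrite in_hook_turned in_turned => /andP[/andP[]].
rewrite in_turned => /andP[bN rb]; rewrite /hook_weight /hook (negPf rb).
have -> : outer_hook la (half_turn N b) =
  [fset half_turn N x | x in ideal_hook (turned N) b]%fset.
  apply/fsetP => x; rewrite in_outer_hook;
    apply/idP/imfsetP => /= [/andP[xla bx]|[y]].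
    have xN : x \in square N.
      by move: bN bx; rewrite !in_square /half_turn /=; lia.
    exists (half_turn N x); last by rewrite half_turnK.
    rewrite in_hook_turned in_turned half_turn_square // half_turnK // xla /=.
    by move: bN xN bx; rewrite !in_square /arm_leg /half_turn /=; lia.
  rewrite in_hook_turned in_turned => /andP[/andP[yN ry] bY] ->; rewrite ry /=.
  by move: bN yN bY; rewrite !in_square /arm_leg /half_turn /=; lia.
rewrite big_imfset /= => [|x y /hook_square xN /hook_square yN]; last first.
  exact: half_turn_inj.
apply: eq_big_seq => x /hook_square xN.
by rewrite -(content_half_turn xN).
Qed.

Definition SPP_in (N : nat) : set {fsfun coyoung la -> nat with 0%N} :=
  [set n | SPP la n /\ forall b, n b != 0%N -> val b \in square N].

Lemma turned_notin_young N (u : turned N) : half_turn N (val u) \notin young la.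
Proof. by have := valP u; rewrite in_turned => /andP[]. Qed.

Definition turned_box N (u : turned N) : coyoung la :=
    Sub (half_turn N (val u)) (turned_notin_young u).

Lemma turned_square N (u : turned N) : val u \in square N.
Proof. by have := valP u; rewrite in_turned => /andP[]. Qed.

Lemma turned_box_inj N : injective (@turned_box N).
Proof.
move=> u v /(congr1 val) /= e; apply: val_inj; apply: half_turn_inj e;
  exact: turned_square.
Qed.

Lemma turned_boxP N (b : coyoung la) : val b \in square N ->
    exists u : turned N, b = turned_box u.
Proof.
move=> bN; have ub : half_turn N (val b) \in turned N.
  by rewrite in_turned half_turn_square //= half_turnK // (valP b).
by exists [` ub]%fset; apply: val_inj; rewrite /= half_turnK.
Qed.

Definition of_SPP N (n : {fsfun coyoung la -> nat with 0%N}) :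
    {ffun turned N -> nat} :=
  [ffun u => n (turned_box u)].
Definition to_SPP N (h : {ffun turned N -> nat}) :
    {fsfun coyoung la -> nat with 0%N} :=
  [fsfun b in [fset turned_box u | u in {: turned N}]%fset =>
    extend0 h (half_turn N (val b))].

Lemma to_SPP_turned_box N (h : {ffun turned N -> nat}) u :
    to_SPP h (turned_box u) = h u.
Proof.
rewrite fsfunE in_imfset //= half_turnK ?extend0_val //; exact: turned_square.
Qed.

Lemma to_SPP_out N (h : {ffun turned N -> nat}) b :
    val b \notin square N -> to_SPP h b = 0%N.
Proof.
move=> bN; rewrite fsfunE; case: imfsetP => // -[u _ e]; case/negP: bN.
by rewrite e half_turn_square // turned_square.
Qed.

(** The half-turn carries this to [monotone_has_sum], where the k-th diagonal
    gets the variable of index - k. *)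
Lemma SPP_in_has_sum N :
  fps_has_sum (SPP_in N) (fun n => SPP_weight (content_var R) n)
    (\prod_(b <- outside N) (1 - hookw b)^-1).
Proof.
have q0 (k : int) : (fps_var (- k) : fps int R) mone = 0
  by rewrite /= eq_sym cm1_eq1.
rewrite prod_turned.
have -> : \prod_(b <- turned N) (1 - hookw (half_turn N b))^-1 =
  \prod_(b <- turned N)
    (1 - \prod_(x <- ideal_hook (turned N) b) fps_var (- content x))^-1.
  by apply: eq_big_seq => b bt; rewrite hook_turned.
apply: fps_has_sum_bij (@of_SPP N) (@to_SPP N)
  _ _ _ (monotone_has_sum (@turned_ideal N) q0).
- move=> n [mn nN]; split.
  + by move=> u v uv; rewrite !ffunE; apply: mn; apply: half_turn_le.
  + apply/fsfunP => b; have [bN|bN] := boolP (val b \in square N).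
      by have [u ->] := turned_boxP bN; rewrite to_SPP_turned_box ffunE.
    by rewrite to_SPP_out //; case: eqP (nN b) bN => [->|_ /(_ isT)->].
  + rewrite /SPP_weight (@big_fset_incl _ _ _ _ _ [fset turned_box u | u in {:
      turned N}]%fset).
    * rewrite big_imfset /= => [|u v _ _ /turned_box_inj //];
        rewrite big_enum /=.
      apply: eq_bigr => u _; rewrite ffunE /content_var -(content_half_turn
        (turned_square u)) //.
    * apply/fsubsetP => b; rewrite mem_finsupp => /nN/turned_boxP[u ->];
        exact: in_imfset.
    * by move=> b _; rewrite memNfinsupp => /eqP->; rewrite expr0.
- move=> h mh; split; last by apply/ffunP => u; rewrite ffunE to_SPP_turned_box.
  split=> [b c cb|b].
    have [bN|bN] := boolP (val b \in square N); last by rewrite to_SPP_out.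
    have cN : val c \in square N.
      by move: bN cb; rewrite !in_square /box_le; lia.
    have [[u bu] [v cv]] := (turned_boxP bN, turned_boxP cN);
      rewrite bu cv !to_SPP_turned_box; apply: mh.
    rewrite -(half_turnK (turned_square u)) -(half_turnK (turned_square v)).
    by move: cb; rewrite bu cv; apply: half_turn_le.
  by apply: contraR => bN; rewrite to_SPP_out.
Qed.

Lemma outside_out N b : b \notin young la -> b \notin square N ->
  (N <= #|` hook la b| + (size la + nth 0%N la 0%N))%N.
Proof.
move=> bla; rewrite in_square negb_and -!leqNgt.
by have := lt_hook1 bla; have := lt_hook2 bla; lia.
Qed.

Lemma hook_weight_below (b : box) : eq_below #|` hook la b| (hookw b) 0.
Proof. by apply: eq_below0_prod => c _; apply: content_var_const. Qed.

Lemma hook_weight_const (b : box) : hookw b mone = 0.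
Proof.
apply: hook_weight_below; rewrite mdeg1 cardfs_gt0.
by apply/fset0Pn; exists b; apply: hook_refl.
Qed.

(** By monotonicity n is nonzero on the whole external hook of b. *)
Lemma SPP_weight_below n : SPP la n ->
  forall b, n b != 0%N -> eq_below #|` hook la (val b)| (SPP_weight
    (content_var R) n) 0.
Proof.
move=> mn b nb m mN; apply: (@eq_below0_prod _ _ _ (enum_fset (finsupp n))) =>
  [c|].
  rewrite mem_finsupp -lt0n => nc.
  by apply: (eq_below0X (content_var_const R (val c)) nc); rewrite mdeg1.
apply: leq_trans mN _.
have <- : #|` [fset (val c : box) | c in finsupp n]%fset| = size (finsupp n).
  by rewrite card_imfset //; apply: val_inj.
apply: fsubset_leq_card; apply/fsubsetP => x.
rewrite /hook (negPf (valP b)) in_outer_hook => /andP[xla bx].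
apply/imfsetP; exists (Sub x xla) => //=; rewrite mem_finsupp -lt0n.
apply: leq_trans (mn b (Sub x xla) _); first by rewrite lt0n.
by move: bx; rewrite /box_le /=; lia.
Qed.

(** Side of a square outside of which all external hooks are longer than the
    degree of m, and which contains the diagram. *)
Definition cutoff (m : {cmonom int}) : nat :=
  ((mdeg m).+1 + (size la + nth 0%N la 0%N))%N.

Lemma cutoff_hook m b : b \notin young la -> b \notin square (cutoff m) ->
  (mdeg m < #|` hook la b|)%N.
Proof. by move=> bla bN; have := outside_out bla bN; rewrite /cutoff; lia. Qed.

(** The coefficient at m of the products over [outside N] does not depend on N
    from [cutoff m] on. *)
Definition SPP_series : fps int R :=
  FPS (fun m => (\prod_(b <- outside (cutoff m)) (1 - hookw b)^-1) m).

Lemma SPP_has_sum :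
  fps_has_sum (SPP la) (fun n => SPP_weight (content_var R) n) SPP_series.
Proof.
move=> m; set N := cutoff m; have [A AN As] := @SPP_in_has_sum N m.
(* The other skew plane partitions of B do not contribute at m. *)
exists A => [n /AN[]//|B AB BD];
  rewrite -[RHS](As [fset n in B | `[< SPP_in N n >]]%fset).
- rewrite !fps_coef_sum; apply/esym/big_fset_incl.
    by apply/fsubsetP => n; rewrite in_fset inE => /andP[].
  move=> n nB; rewrite in_fset inE /= nB /= => /asboolPn nN.
  have [b nb bN] : exists2 b, n b != 0%N & val b \notin square N.
    apply: contra_notP nN => out; split=> [|b nb]; first exact: BD.
    by apply: contra_notT out => bN; exists b.
  apply: (SPP_weight_below (BD n nB) nb); exact: cutoff_hook (valP b) bN.
- apply/fsubsetP => n nA; rewrite in_fset inE (fsubsetP AB _ nA) /=.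
  by apply/asboolP/AN.
- by move=> n /=; rewrite in_fset inE => /andP[_ /asboolP].
Qed.

Lemma SPP_has_prod :
  fps_has_prod (~` [set` young la]) (fun b => (1 - hookw b)^-1) SPP_series.
Proof.
move=> m; set N := cutoff m; exists (outside N) => [b|B AB BD].
  by rewrite /= in_outside => /andP[_ /negP].
(* Up to the degree of m, the factors outside the square are 1. *)
pose F b := if b \in outside N then (1 - hookw b)^-1 else 1.
transitivity ((\prod_(b <- B) F b) m).
  rewrite big_seq [in RHS]big_seq.
  apply: (eq_below_prod (N := (mdeg m).+1)) => // b bB; rewrite /F in_outside.
  have bla : b \notin young la by apply/negP/BD.
  rewrite bla andbT; case: ifPn => // bN;
    apply: eq_below_inv1B (hook_weight_const b).
  move=> k km; apply: hook_weight_below; apply: leq_trans (cutoff_hook bla bN).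
  by rewrite ltnS in km *.
rewrite -(big_fset_incl _ AB) => [|b _ /negPf bN]; last by rewrite /F bN.
rewrite /SPP_series /= -/N; congr (fps_coef _ _).
by apply: eq_big_seq => b bN; rewrite /F bN.
Qed.

End Shape.

Theorem proposition2p2 (R : comNzRingType) (la : seq nat)
    (la_partition : is_partition la) :
  fps_has_sum (RPP la) (fun n => RPP_weight (content_var R) n)
    (\prod_(b <- young la) (1 - hook_weight la (content_var R) b)^-1) /\
  (exists S : fps int R,
    fps_has_sum (SPP la) (fun n => SPP_weight (content_var R) n) S /\
    fps_has_prod (~` [set` young la])
      (fun b => (1 - hook_weight la (content_var R) b)^-1) S).
Proof.
split; first exact: RPP_has_sum.
by exists (SPP_series R la); split; [exact: SPP_has_sum|exact: SPP_has_prod].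
Qed.
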